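(* Let $n\ge 0$, $p\geq 2$ and $q\ge 2$ be integers. Let $\mathcal{M}$ be a family (set) of Meshalkin sequences of length $p$ in $\mathbb{P}^{n-1}(q)$ and, for each $k\in\{1,\dots,p\}$, let $\mathcal{M}_k = \{ a_k : (a_1,\dots,a_p)\in\mathcal{M}\}$. Suppose that $\mathcal{M}_k$ is an antichain for each $k<p$. Then (a) $\displaystyle \sum_{a\in \mathcal{M}} \frac{1}{\left[ {n \atop r(a)} \right] q^{ s_2(r(a)) }} \leq 1$, and (b) $\displaystyle |\mathcal{M}| \leq \max_{\alpha} \left[ {n \atop \alpha} \right] q^{ s_2(\alpha) } = \left[ {n \atop \beta} \right] q^{ s_2(\beta) }$, where $\alpha$ ranges over all $p$-tuples of nonnegative integers with sum $n$, and $\beta=\big(\lceil \tfrac np\rceil,\dots,\lceil \tfrac np\rceil,\lfloor \tfrac np\rfloor,\dots,\lfloor \tfrac np\rfloor\big)$ is the $p$-tuple with sum $n$ in which the number of terms in the initial block of terms $\lceil \tfrac np\rceil$ is the least nonnegative residue of $n$ modulo $p$. (c) Equality holds in (a) and (b) if, for each $k$, $\mathcal{M}_k$ consists of all flats of rank $\lceil \tfrac np\rceil$ or all flats of rank $\lfloor \tfrac np\rfloor$.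
   Context: $\mathbb{P}^{n-1}(q)$ denotes a (finite) projective geometry of order $q$ and rank $n$ (dimension $n-1$): a set of points and lines such that any two distinct points lie on a unique line, every line has exactly $q+1$ points, and the Veblen–Young axiom holds. By convention it is empty if $n=0$, a single point if $n=1$, and a line of $q+1$ points if $n=2$. A flat (subspace) is a set of points containing, with any two distinct points, the whole line through them. The geometry is regarded as its lattice of flats ordered by inclusion, with $\hat 0=\varnothing$, $\hat 1$ the whole set of points, and join $\vee$ (the flat generated by the union). The rank of a flat $a$ is $r(a)=\dim a+1$ (so $r(\hat 0)=0$, points have rank $1$, lines have rank $2$, $r(\hat 1)=n$). A Meshalkin sequence of length $p$ in $\mathbb{P}^{n-1}(q)$ is a sequence $a=(a_1,\dots,a_p)$ of flats with $a_1\vee\dots\vee a_p=\hat 1$ and $r(a_1)+\dots+r(a_p)=n$. Write $r(a)=(r(a_1),\dots,r(a_p))$. An antichain is a set of flats no one of which properly contains another. For $m \ge 0$, $m!_q=(q^m-1)(q^{m-1}-1)\cdots(q-1)$, with $0!_q=1$. For a $p$-tuple $\alpha=(\alpha_1,\dots,\alpha_p)$ of nonnegative integers with sum $n$, the Gaussian multinomial coefficient is $\left[ {n \atop \alpha} \right]=\frac{n!_q}{\alpha_1!_q\cdots\alpha_p!_q}$. Also $s_2(\alpha)=\sum_{i<j}\alpha_i\alpha_j$.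
   Formalization: In (c), the family M is additionally assumed to contain every Meshalkin sequence (a_1,…,a_p) with a_k in M_k for all k; without this (c) fails, e.g. n=p=q=2, points x,y,z, M={(x,y),(y,z),(z,x)}. *)

(* Defs.v *)
From mathcomp Require Export all_boot all_order all_algebra.

Set Implicit Arguments.
Unset Strict Implicit.
Unset Printing Implicit Defensive.

Import Order.TTheory GRing.Theory Num.Theory.

Section Geometry.

Variables (T : finType) (lines : {set {set T}}).
Implicit Types A B F L : {set T}.

Definition flat A : bool :=
  [forall x in A, forall y in A, (x != y) ==>
    [forall L in lines, (x \in L) && (y \in L) ==> (L \subset A)]].

Definition span A : {set T} := \bigcap_(F | flat F && (A \subset F)) F.

(* Least number of points generating the same flat as A; for a flat A this is
   dim A + 1. *)
Definition rank A : nat := #|[arg min_(B < A | span B == span A) #|B| ]|.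

Definition flats_of_rank (r : nat) : {set {set T}} :=
  [set A | flat A & rank A == r].

(* The geometry P^{n-1}(q), not necessarily Desarguesian. There are no lines
   when n <= 1, so q is then unconstrained. *)
Record projective_geometry (n q : nat) : Prop := ProjectiveGeometry {
  pg_line : forall x y : T, x != y ->
    exists! L, [/\ L \in lines, x \in L & y \in L];
  pg_order : forall L, L \in lines -> #|L| = q.+1;
  (* Veblen-Young: if the lines ab and cd meet, so do the lines ac and bd. *)
  pg_veblen : forall (a b c d : T) (Lab Lcd Lac Lbd : {set T}),
    uniq [:: a; b; c; d] ->
    [/\ Lab \in lines, a \in Lab & b \in Lab] ->
    [/\ Lcd \in lines, c \in Lcd & d \in Lcd] ->
    [/\ Lac \in lines, a \in Lac & c \in Lac] ->
    [/\ Lbd \in lines, b \in Lbd & d \in Lbd] ->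
    Lab :&: Lcd != set0 -> Lac :&: Lbd != set0;
  pg_rank : rank [set: T] = n
}.

Definition ranks (p : nat) (a : {ffun 'I_p -> {set T}}) : 'I_p -> nat :=
  fun k => rank (a k).

Definition meshalkin (n p : nat) (a : {ffun 'I_p -> {set T}}) : Prop :=
  [/\ forall k, flat (a k),
      span (\bigcup_k a k) = [set: T]
    & \sum_k ranks a k = n].

(* The family M_k of k-th terms of the sequences in M. *)
Definition component (p : nat) (M : {set {ffun 'I_p -> {set T}}}) (k : 'I_p) :
  {set {set T}} := [set a k | a : {ffun 'I_p -> {set T}} in M].

Definition antichain (C : {set {set T}}) : Prop :=
  forall A B, A \in C -> B \in C -> ~~ (A \proper B).

End Geometry.

Local Open Scope ring_scope.

Definition qfact (q m : nat) : rat := \prod_(1 <= i < m.+1) (q%:R ^+ i - 1).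

Definition gauss_multinomial (q n p : nat) (alpha : 'I_p -> nat) : rat :=
  qfact q n / \prod_k qfact q (alpha k).

Definition s2 (p : nat) (alpha : 'I_p -> nat) : nat :=
  (\sum_(i < p) \sum_(j < p | i < j) alpha i * alpha j)%N.

(* [n; alpha] q^{s2(alpha)} *)
Definition meshalkin_number (q n p : nat) (alpha : 'I_p -> nat) : rat :=
  gauss_multinomial q n alpha * q%:R ^+ s2 alpha.

(* The maximum over all p-tuples with sum n; such a tuple has terms at most n,
   whence the type 'I_n.+1. For p > 0 there is such a tuple, and for q > 1 all
   the numbers compared are positive, so the default value 0 is irrelevant. *)
Definition max_meshalkin_number (q n p : nat) : rat :=
  \big[Num.max/0]_(alpha : {ffun 'I_p -> 'I_n.+1} |
                    (\sum_k alpha k == n)%N)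
     meshalkin_number q n (fun k => nat_of_ord (alpha k)).

Definition floor_div (n p : nat) : nat := (n %/ p)%N.
Definition ceil_div (n p : nat) : nat := ((n + p.-1) %/ p)%N.

Definition beta (n p : nat) : 'I_p -> nat :=
  fun k => if (k < n %% p)%N then ceil_div n p else floor_div n p.

(* Main.v *)
Require Import Defs.
From mathcomp Require Import all_boot all_order all_algebra.
From mathcomp Require Import zify ring.

Import Order.TTheory GRing.Theory Num.Theory.

(** Everything rests on one count. If F is a flat and x a point outside F, the
    flat spanned by F and x is the cone of F over x, the union of the lines from
    x to the points of F: this is what the Veblen-Young axiom says. These lines
    share only x, so the cone has 1 + q |F| points. By induction a flat of rank
    r has exactly [r]_q = 1 + q + ... + q^(r-1) points, and the whole theory of
    rank (monotony, submodularity) is read off from cardinals.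

    Write [m; k] for Gaussian binomials. Averaging over the points x of C \ P
    passes from the interval [P, C] of flats to the shorter intervals
    [P v x, C]. It gives, by induction on the length of the interval:
    - the LYM inequality: the sum of 1 / [m; rank A] over an antichain is at
      most 1, with equality for all flats of one given rank ([lubell_le1],
      [lubell_flats_of_rank]);
    - the number q^(k (m - k)) of complements of a flat of rank k in a flat of
      rank m ([card_complements]).

    A Meshalkin sequence in a flat C of rank m consists of a flat A, say of rank
    k, a complement c of A in C, and a Meshalkin sequence in c: subadditivity of rank
    leaves no other possibility. Its weight, the inverse of
    [m; alpha] q^(s2 alpha), factors accordingly into
    1 / ([m; k] q^(k (m - k))) and the weight of the tail. Summing over the tail
    (induction on the length), then over the q^(k (m - k)) complements, then
    over A with LYM yields (a) in [sum_weight_le1]. If the family consists of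
    all sequences with prescribed ranks, every step is an equality, whence (c)
    in [sum_weight_of_ranks].

    By (a), |M| is at most the largest number [n; alpha] q^(s2 alpha). To find the
    latter for (b), the identity s2 alpha + sum_k C(alpha_k, 2) = C(m, 2) turns
    [m; alpha] q^(s2 alpha) into a constant divided by the product of the costs
    f(alpha_k), with f(k) = k!_q q^C(k, 2). The ratio f(k+1) / f(k) increases
    with k, so f is log-convex and lies above the geometric progression through
    f(t) and f(t+1). Hence the product of the costs is least when all parts are
    t or t + 1 ([meshalkin_number_le_balanced]). *)

Set Implicit Arguments.
Unset Strict Implicit.
Unset Printing Implicit Defensive.

(** * Flats and their spans *)

Section Span.
Variables (T : finType) (lines : {set {set T}}).
Implicit Types (x y : T) (A B F L : {set T}).
Local Notation flat := (Defs.flat lines).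
Local Notation span := (Defs.span lines).

Lemma flatP A :
  reflect (forall x y L, x \in A -> y \in A -> x != y ->
             L \in lines -> x \in L -> y \in L -> L \subset A)
          (flat A).
Proof.
apply: (iffP forall_inP) => [flA x y L xA yA nxy Ll xL yL | flA x xA].
  have /forall_inP/(_ y yA)/implyP/(_ nxy)/forall_inP/(_ L Ll) := flA x xA.
  by rewrite xL yL.
apply/forall_inP=> y yA; apply/implyP=> nxy; apply/forall_inP=> L Ll.
by apply/implyP=> /andP[]; apply: flA nxy Ll.
Qed.

Lemma flat_span A : flat (span A).
Proof.
apply/flatP=> x y L /bigcapP xS /bigcapP yS nxy Ll xL yL.
apply/bigcapsP=> F FA; have /andP[/flatP flF _] := FA.
exact: flF (xS _ FA) (yS _ FA) nxy Ll xL yL.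
Qed.

Lemma subset_span A : A \subset span A.
Proof. by apply/bigcapsP=> F /andP[]. Qed.

Lemma span_min A F : flat F -> A \subset F -> span A \subset F.
Proof. by move=> flF AF; apply: bigcap_inf; rewrite flF. Qed.

Lemma span_id F : flat F -> span F = F.
Proof. by move=> flF; apply/eqP; rewrite eqEsubset span_min ?subset_span. Qed.

Lemma spanS A B : A \subset B -> span A \subset span B.
Proof.
by move=> AB; apply: span_min (flat_span B) (subset_trans AB (subset_span B)).
Qed.

Lemma span_spanU A B : span (A :|: span B) = span (A :|: B).
Proof.
apply/eqP; rewrite eqEsubset andbC spanS ?setUS ?subset_span //=.
apply: span_min (flat_span _) _; rewrite subUset spanS ?subsetUr // andbT.
exact: subset_trans (subsetUl A B) (subset_span _).
Qed.

Lemma flat0 : flat set0.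
Proof. by apply/flatP=> x y L; rewrite inE. Qed.

End Span.

(** * The cone over a flat *)

Section Geometry.
Variables (T : finType) (lines : {set {set T}}) (n q : nat).
Hypothesis geom : projective_geometry lines n q.
Implicit Types (x y : T) (F L : {set T}).
Local Notation flat := (Defs.flat lines).
Local Notation span := (Defs.span lines).

Definition line x y : {set T} :=
  odflt set0 [pick L in lines | (x \in L) && (y \in L)].

Lemma lineP x y : x != y -> [/\ line x y \in lines, x \in line x y & y \in line x y].
Proof.
move=> nxy; rewrite /line; case: pickP => [L /andP[Ll /andP[xL yL]] // | noL].
have [L [[Ll xL yL] _]] := pg_line geom nxy.
by have := noL L; rewrite Ll xL yL.
Qed.

Lemma line_uniq x y L1 L2 : x != y -> L1 \in lines -> L2 \in lines ->
  x \in L1 -> y \in L1 -> x \in L2 -> y \in L2 -> L1 = L2.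
Proof.
move=> nxy l1 l2 x1 y1 x2 y2; have [L [_ uniqL]] := pg_line geom nxy.
by rewrite -(uniqL L1) // (uniqL L2).
Qed.

Lemma line_flat F x y : flat F -> x \in F -> y \in F -> x != y ->
  line x y \subset F.
Proof.
by move=> /flatP flF xF yF nxy; have [ll xl yl] := lineP nxy; apply: flF nxy ll _ _.
Qed.

(** If two lines from x to points of F share a second point y, they are equal;
    two points of F on that line would then put x in F. *)
Lemma line_trace F x a b y : flat F -> x \notin F -> a \in F -> b \in F ->
  y != x -> y \in line x a -> y \in line x b -> a = b.
Proof.
move=> flF xF aF bF nyx ya yb; apply/eqP/negPn/negP=> nab.
have nxa : x != a by apply: contraNneq xF => ->.
have nxb : x != b by apply: contraNneq xF => ->.
have [la xa aa] := lineP nxa; have [lb xb bb] := lineP nxb.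
have ab := line_uniq nyx la lb ya xa yb xb.
rewrite -ab in bb; move/flatP: flF => /(_ a b _ aF bF nab la aa bb)/subsetP/(_ x xa).
by rewrite (negPf xF).
Qed.

Definition cone F x : {set T} :=
  x |: \bigcup_a (if a \in F then line x a :\ x else set0).

Lemma coneP F x y :
  reflect (y = x \/ exists2 a, a \in F & y \in line x a) (y \in cone F x).
Proof.
rewrite !inE; apply: (iffP orP) => [[/eqP-> | ]|].
- by left.
- case/bigcupP=> a _; case: ifP => [aF | _]; last by rewrite inE.
  by case/setD1P=> _ ya; right; exists a.
case=> [-> | [a aF ya]]; first by left.
case: (eqVneq y x) => [_|nyx]; first by left.
by right; apply/bigcupP; exists a => //; rewrite aF !inE nyx.
Qed.

Lemma sub_cone F x : flat F -> x \notin F -> F \subset cone F x.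
Proof.
move=> flF xF; apply/subsetP=> a aF; apply/coneP; right; exists a => //.
by have nxa : x != a by [apply: contraNneq xF => ->]; case: (lineP nxa).
Qed.

(** Let w lie on a line that joins points y and z of the lines xa and xb. The
    Veblen-Young axiom, used twice, makes the line xw meet ab, hence F; so w lies
    on a line from x to a point of F. *)
Lemma flat_cone F x : flat F -> x \notin F -> flat (cone F x).
Proof.
move=> flF xF; apply/flatP=> y z L yK zK nyz Ll yL zL.
have FK := subsetP (sub_cone flF xF).
have nF a : a \in F -> x != a by move=> aF; apply: contraNneq xF => ->.
have lineK a M u : a \in F -> u \in line x a -> u != x ->
    M \in lines -> x \in M -> u \in M -> M \subset cone F x.
  move=> aF ua nux Ml xM uM; apply/subsetP=> v vM; apply/coneP; right.
  exists a => //; have [la xa aa] := lineP (nF a aF).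
  by rewrite -(line_uniq nux Ml la uM xM ua xa).
have [ey|nyx] := eqVneq y x.
  rewrite ey in yL nyz.
  have [ez|[b bF zb]] := coneP _ _ _ zK; first by rewrite ez eqxx in nyz.
  by apply: (lineK b L z) => //; rewrite eq_sym.
have [ey|[a aF ya]] := coneP _ _ _ yK; first by rewrite ey eqxx in nyx.
have [ez|nzx] := eqVneq z x.
  by rewrite ez in zL; apply: (lineK a L y).
have [ez|[b bF zb]] := coneP _ _ _ zK; first by rewrite ez eqxx in nzx.
have [la xa aa] := lineP (nF a aF); have [lb xb bb] := lineP (nF b bF).
have [eab|nab] := eqVneq a b.
  rewrite -eab in zb; rewrite (line_uniq nyz Ll la yL zL ya zb).
  by apply: (lineK a _ a) => //; rewrite eq_sym nF.
apply/subsetP=> w wL.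
have [->|nwx] := eqVneq w x; first by apply/coneP; left.
have [->//|nwy] := eqVneq w y.
have [wF|nwF] := boolP (w \in F); first exact: FK.
have nwa : w != a by apply: contraNneq nwF => ->.
have nwb : w != b by apply: contraNneq nwF => ->.
have nby : b != y.
  apply: contraNneq nab => eby; apply/eqP.
  by apply: (line_trace flF xF aF bF nyx ya); rewrite -eby.
have nxw : x != w by rewrite eq_sym.
have nxy : x != y by rewrite eq_sym.
have nyw : y != w by rewrite eq_sym.
have nbw : b != w by rewrite eq_sym.
have naw : a != w by rewrite eq_sym.
have nbx : b != x by rewrite eq_sym nF.
have [lxw x_xw w_xw] := lineP nxw.
have [lab a_ab b_ab] := lineP nab.
have [lbw b_bw w_bw] := lineP nbw.
(* The line bw meets the sides xz and yz of the triangle xyz, hence also xy. *)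
have meet1 : line b w :&: line x a != set0.
  apply: (pg_veblen geom (a:=b) (b:=x) (c:=w) (d:=y)
    (Lab := line x b) (Lcd := L)) => //.
    by rewrite /= !inE !negb_or nbx nbw nby nxw nxy nwy.
  by apply/set0Pn; exists z; rewrite inE zb.
(* Hence xa and bw meet, and so do xw and ab. *)
have meet2 : line x w :&: line a b != set0.
  apply: (pg_veblen geom (a:=x) (b:=a) (c:=w) (d:=b)
    (Lab := line x a) (Lcd := line b w)) => //.
    by rewrite /= !inE !negb_or nxw (nF a) // (nF b) // naw nab nwb.
  by rewrite setIC.
have /set0Pn[c /setIP[cxw cab]] := meet2.
have cF : c \in F by apply: (subsetP (line_flat flF aF bF nab)).
apply/coneP; right; exists c => //.
have [lc xc cc] := lineP (nF c cF).
by rewrite -(line_uniq (nF c cF) lxw lc x_xw cxw xc cc).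
Qed.

Lemma span_setU1 F x : flat F -> x \notin F -> span (x |: F) = cone F x.
Proof.
move=> flF xF; apply/eqP; rewrite eqEsubset; apply/andP; split.
  apply: span_min (flat_cone flF xF) _; rewrite subUset sub_cone // andbT sub1set.
  by apply/coneP; left.
have xS : x \in span (x |: F) by rewrite (subsetP (subset_span _ _)) ?setU11.
apply/subsetP=> y /coneP[-> // | [a aF]]; apply: subsetP.
have nxa : x != a by apply: contraNneq xF => ->.
apply: line_flat (flat_span _ _) xS _ nxa.
by rewrite (subsetP (subset_span _ _)) ?setU1r.
Qed.

Lemma card_span_setU1 F x : flat F -> x \notin F ->
  #|span (x |: F)| = (q * #|F|).+1.
Proof.
move=> flF xF; rewrite span_setU1 // cardsU1.
have -> : x \notin \bigcup_a (if a \in F then line x a :\ x else set0).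
  by apply/bigcupP=> [[a _]]; case: ifP => _; rewrite !inE ?eqxx.
rewrite add1n -sum1_card; congr _.+1.
rewrite partition_disjoint_bigcup => [|a b nab]; last first.
  case: ifP => aF; last by rewrite disjoints_subset sub0set.
  case: ifP => bF; last by rewrite disjoint_sym disjoints_subset sub0set.
  apply/pred0Pn=> -[y /=]; rewrite !inE => /andP[/andP[nyx ya] /andP[_ yb]].
  by rewrite (line_trace flF xF aF bF nyx ya yb) eqxx in nab.
rewrite (bigID (mem F)) /= [X in (_ + X)%N]big1 => [|a /negPf aF]; last first.
  by rewrite aF big_set0.
rewrite addn0 (eq_bigr (fun=> q)) => [|a aF]; first by rewrite sum_nat_const mulnC.
have nxa : x != a by apply: contraNneq xF => ->.
have [la xa aa] := lineP nxa; rewrite aF sum1_card.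
by have := cardsD1 x (line x a); rewrite xa (pg_order geom la) => -[].
Qed.

End Geometry.

(** * Rank and number of points *)

Definition qnum (q m : nat) : nat := \sum_(i < m) q ^ i.

Lemma qnumS q m : qnum q m.+1 = (q * qnum q m).+1.
Proof.
rewrite /qnum big_ord_recl expn0 add1n big_distrr; congr _.+1.
by apply: eq_bigr => i _; rewrite lift0 expnS.
Qed.

Lemma qnumD q m k : qnum q (m + k) = qnum q m + q ^ m * qnum q k.
Proof.
elim: m => [|m IH]; first by rewrite /qnum big_ord0 expn0 mul1n.
by rewrite addSn !qnumS IH mulnDr mulnA -expnS.
Qed.

Lemma qnum_leq q m k : 0 < q -> (qnum q m <= qnum q k) = (m <= k).
Proof.
move=> q_gt0; have [/subnKC<- | ltkm] := leqP m k.
  by rewrite qnumD leq_addr.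
apply/negbTE; rewrite -ltnNge -(subnKC ltkm) addSnnS qnumD -[X in X < _]addn0.
by rewrite ltn_add2l qnumS muln_gt0 expn_gt0 q_gt0.
Qed.

Lemma qnum_inj q : 0 < q -> injective (qnum q).
Proof.
by move=> q_gt0 m k /eqP; rewrite eqn_leq !qnum_leq // -eqn_leq => /eqP.
Qed.

Section Rank.
Variables (T : finType) (lines : {set {set T}}) (n q : nat).
Hypothesis (geom : projective_geometry lines n q) (q_gt0 : 0 < q).
Implicit Types (x y : T) (A B C F I P : {set T}).
Local Notation flat := (Defs.flat lines).
Local Notation span := (Defs.span lines).
Local Notation rank := (Defs.rank lines).

(** Omitting, in a list of generators, each point that lies in the span of the
    preceding ones leaves the span unchanged, and each point kept takes the size
    [k]_q of the span to 1 + q [k]_q = [k+1]_q. *)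
Lemma independent_generators A :
  exists2 B : {set T}, span B = span A & #|B| <= #|A| /\ #|span B| = qnum q #|B|.
Proof.
have [m leAm] := ubnP #|A|; elim: m A leAm => // m IHm A leAm.
have [->|[x xA]] := set_0Vmem A.
  by exists set0 => //; rewrite cards0 span_id ?flat0 // cards0 /qnum big_ord0.
have cardA := cardsD1 x A; rewrite xA add1n in cardA.
have [|B eqBA [leBA cardB]] := IHm (A :\ x); first by rewrite cardA in leAm.
have eqxB : span (x |: B) = span A.
  by rewrite -span_spanU eqBA span_spanU setD1K.
have [xB | xB] := boolP (x \in span B).
  exists B; last by rewrite cardA ltnW.
  rewrite -eqxB -span_spanU (setUidPr _) ?sub1set //.
  by rewrite (span_id (flat_span _ _)).
exists (x |: B) => //.
have -> : #|x |: B| = #|B|.+1.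
  by rewrite cardsU1 (contraNN _ xB) // => /(subsetP (subset_span _ _)).
by rewrite cardA ltnS qnumS -cardB -span_spanU
  (card_span_setU1 geom (flat_span _ _)).
Qed.

(** A smallest set of generators admits no omission, so the size of the span is
    determined by the rank, and determines it in turn. *)
Lemma card_span A : #|span A| = qnum q (rank A).
Proof.
rewrite /Defs.rank; case: arg_minnP => [|B0 /eqP eqB0 minB0]; first exact: eqxx.
have [B eqB [leB cardB]] := independent_generators B0.
have -> : #|B0| = #|B|.
  by apply/eqP; rewrite eqn_leq leB minB0 // eqB eqB0.
by rewrite -eqB0 -eqB.
Qed.

Lemma card_flat F : flat F -> #|F| = qnum q (rank F).
Proof. by move=> flF; rewrite -card_span span_id. Qed.

Lemma rank_span A : rank (span A) = rank A.
Proof.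
by apply: (qnum_inj q_gt0); rewrite -!card_span (span_id (flat_span _ _)).
Qed.

Lemma rank0 : rank set0 = 0.
Proof.
by apply: (qnum_inj q_gt0); rewrite -card_flat ?flat0 // cards0 /qnum big_ord0.
Qed.

Lemma rankS A B : A \subset B -> rank A <= rank B.
Proof.
move=> AB; rewrite -(qnum_leq _ _ q_gt0) -!card_span.
by rewrite subset_leq_card ?spanS.
Qed.

Lemma flat_rank_eq A B : flat A -> flat B -> A \subset B -> rank B <= rank A ->
  A = B.
Proof.
move=> flA flB AB; rewrite -(qnum_leq _ _ q_gt0) -!card_flat // => leBA.
by apply/eqP; rewrite eqEcard AB.
Qed.

Lemma rank_setU1 F x : flat F -> x \notin F -> rank (span (x |: F)) = (rank F).+1.
Proof.
move=> flF xF; apply: (qnum_inj q_gt0).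
by rewrite -card_flat ?flat_span // (card_span_setU1 geom) // qnumS -card_flat.
Qed.

(** Submodularity, with I any flat below both: B is reached from I by adding
    points, and adding the same points to A raises the rank at most as often. *)
Lemma rank_setU A B I : flat A -> flat B -> flat I -> I \subset A -> I \subset B ->
  rank (A :|: B) + rank I <= rank A + rank B.
Proof.
move=> flA flB flI; have [m] := ubnP (rank B - rank I).
elim: m A I flA flI => // m IHm A I flA flI leBI IA IB.
have [BI | ] := boolP (B \subset I).
  by rewrite (setUidPl (subset_trans BI IA)) leq_add2l rankS.
case/subsetPn=> x xB xI.
have ltIB : rank I < rank B.
  rewrite ltnNge; apply: contraNN xI => leBI'.
  by rewrite (flat_rank_eq flI flB IB leBI').
have rkI := rank_setU1 flI xI.
have rkA : rank (span (x |: A)) <= (rank A).+1.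
  have [xA|xA] := boolP (x \in A); last by rewrite rank_setU1.
  by rewrite (setUidPr _) ?sub1set // span_id.
have IHx : rank (span (x |: A) :|: B) + (rank I).+1 <= rank (span (x |: A)) + rank B.
  rewrite -rkI; apply: IHm; rewrite ?flat_span ?spanS ?setUS //; first by lia.
  by rewrite span_min // subUset sub1set xB.
have le1 : rank (A :|: B) <= rank (span (x |: A) :|: B).
  by apply: rankS; apply: setSU; apply: subset_trans (subsetUr _ _) (subset_span _ _).
lia.
Qed.

End Rank.

(** * Gaussian binomial coefficients *)

Local Open Scope ring_scope.

Definition qbinom (q m k : nat) : rat :=
  qfact q m / (qfact q k * qfact q (m - k)).

Section QNumbers.
Variable q : nat.
Hypothesis q_ge2 : (2 <= q)%N.

Lemma qfact0 : qfact q 0 = 1.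
Proof. by rewrite /qfact big_geq. Qed.

Lemma qfactS m : qfact q m.+1 = qfact q m * (q%:R ^+ m.+1 - 1).
Proof. by rewrite /qfact big_nat_recr. Qed.

Lemma qexp_gt1 m : 1 < q%:R ^+ m.+1 :> rat.
Proof. by rewrite exprn_egt1 // ltr1n. Qed.

Lemma qexp_gt0 m : 0 < q%:R ^+ m :> rat.
Proof. by rewrite exprn_gt0 // ltr0n ltnW. Qed.

Lemma qfact_gt0 m : 0 < qfact q m.
Proof.
elim: m => [|m IHm]; first by rewrite qfact0.
by rewrite qfactS mulr_gt0 // subr_gt0 qexp_gt1.
Qed.

Lemma qbinom_gt0 m k : 0 < qbinom q m k.
Proof. by rewrite divr_gt0 ?mulr_gt0 ?qfact_gt0. Qed.

Lemma qbinom0 m : qbinom q m 0 = 1.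
Proof. by rewrite /qbinom qfact0 mul1r subn0 divff // gt_eqF ?qfact_gt0. Qed.

Lemma qnumE m : (qnum q m)%:R * (q%:R - 1) = q%:R ^+ m - 1 :> rat.
Proof.
elim: m => [|m IHm]; first by rewrite /qnum big_ord0 mul0r subrr.
rewrite qnumS -addn1 natrD natrM mulrDl -mulrA IHm exprS; ring.
Qed.

(** The absorption identity [m+1; k+1] [k+1]_q = [m+1]_q [m; k], in the form in
    which it meets the averages of [lubell_average]. *)
Lemma qbinomS m k : (k <= m)%N ->
  (qbinom q m.+1 k.+1)^-1 * (qnum q m.+1)%:R =
  (qnum q k.+1)%:R * (qbinom q m k)^-1.
Proof.
move=> lekm; have q1 : q%:R - 1 != 0 :> rat.
  by rewrite gt_eqF // subr_gt0 ltr1n.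
apply: (mulIf q1); rewrite -mulrA qnumE [RHS]mulrAC qnumE /qbinom subSS !qfactS.
have fm := qfact_gt0 m; have fk := qfact_gt0 k; have fd := qfact_gt0 (m - k).
have em := qexp_gt1 m; have ek := qexp_gt1 k.
have em1 : q%:R ^+ m.+1 - 1 != 0 :> rat by rewrite gt_eqF ?subr_gt0.
have ek1 : q%:R ^+ k.+1 - 1 != 0 :> rat by rewrite gt_eqF ?subr_gt0.
by field; rewrite em1 ek1 !gt_eqF.
Qed.

End QNumbers.

(** * LYM inequality and complements, by averaging over points *)

Section LYM.
Variables (T : finType) (lines : {set {set T}}) (n q : nat).
Hypothesis (geom : projective_geometry lines n q) (q_ge2 : (2 <= q)%N).
Implicit Types (x y : T) (A B C P : {set T}) (F : {set {set T}}).
Local Notation flat := (Defs.flat lines).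
Local Notation span := (Defs.span lines).
Local Notation rank := (Defs.rank lines).

Let q_gt0 : (0 < q)%N := ltnW q_ge2.

Lemma card_setD_flat P C : flat P -> flat C -> P \subset C ->
  #|C :\: P| = (q ^ rank P * qnum q (rank C - rank P))%N.
Proof.
move=> flP flC PC; rewrite cardsDS // !(card_flat geom) //.
by rewrite -[in LHS](subnKC (rankS geom q_gt0 PC)) qnumD addKn.
Qed.

Lemma sub_span_setU1 P A x : flat A ->
  (span (x |: P) \subset A) = (x \in A) && (P \subset A).
Proof.
move=> flA; rewrite -sub1set -subUset; apply/idP/idP => [|/(span_min flA) //].
exact: subset_trans (subset_span _ _).
Qed.

(** The sum in the LYM inequality, for the part of F in the interval [P, C]. *)
Definition lubell F P C : rat :=
  \sum_(A in F | [&& flat A, P \subset A & A \subset C])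
    (qbinom q (rank C - rank P) (rank A - rank P))^-1.

(** A member A of F is counted on the right once for each point x of A \ P. There
    are q^(rank P) [k]_q such points among the q^(rank P) [m]_q of C \ P, where k
    and m are the ranks of A and C over P, and [m; k] [k]_q = [m]_q [m-1; k-1].
    If P itself belonged to F it would be counted on the left only. *)
Lemma lubell_average F P C : flat P -> flat C -> P \subset C -> P \notin F ->
  lubell F P C * #|C :\: P|%:R = \sum_(x in C :\: P) lubell F (span (x |: P)) C.
Proof.
move=> flP flC PC PF; rewrite mulr_suml [RHS](exchange_big_dep
  [pred A | (A \in F) && [&& flat A, P \subset A & A \subset C]]) /=; last first.
  move=> x A _ /andP[-> /and3P[flA]]; rewrite sub_span_setU1 // flA.
  by case/andP=> _ -> ->.
apply: eq_bigr => A /andP[AF /and3P[flA PA AC]].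
have ltPA : (rank P < rank A)%N.
  rewrite ltnNge; apply: contraNN PF => leAP.
  by rewrite (flat_rank_eq geom q_gt0 flP flA PA leAP).
have leAC := rankS geom q_gt0 AC.
rewrite (eq_big (fun x => x \in A :\: P) (fun=>
    (qbinom q (rank C - rank P).-1 (rank A - rank P).-1)^-1)); first last.
- move=> x /andP[/setDP[_ xP] _].
  by rewrite (rank_setU1 geom) // !subnS.
- move=> x /=; rewrite !inE AF flA AC sub_span_setU1 // PA !andbT.
  rewrite -andbA; congr (_ && _).
  by apply/andP/idP => [[] // | xA]; rewrite (subsetP AC).
rewrite sumr_const -[RHS]mulr_natl !card_setD_flat // !natrM mulrCA -mulrA.
congr (_ * _).
case eqN : (rank C - rank P)%N => [|N]; first by lia.
case eqk : (rank A - rank P)%N => [|k]; first by lia.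
by rewrite qbinomS //; lia.
Qed.

Lemma lubell_id F P C : flat P -> P \subset C ->
  {in F, forall A, P \subset A -> A \subset C -> A = P} -> P \in F ->
  lubell F P C = 1.
Proof.
move=> flP PC FP PF; rewrite /lubell (big_pred1 P) => [|A] /=.
  by rewrite subnn qbinom0 ?invr1.
apply/idP/eqP => [/andP[AF /and3P[_ PA AC]] | ->]; first exact: FP.
by rewrite PF flP subxx.
Qed.

(** If P is in F then it is, in an antichain, the only member in the interval.
    Otherwise the sum is the average of the sums for the intervals [P v x, C]. *)
Lemma lubell_le1 F P C : antichain F -> flat P -> flat C -> P \subset C ->
  lubell F P C <= 1.
Proof.
move=> antiF flP flC; have [m] := ubnP (rank C - rank P).
elim: m P flP => // m IHm P flP lem PC.
have [PF | PF] := boolP (P \in F).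
  rewrite lubell_id // => A AF PA AC; apply/eqP; rewrite eq_sym.
  by have := antiF P A PF AF; rewrite properEneq PA andbT negbK.
have [eqPC | ltPC] := eqVproper PC.
  rewrite /lubell big_pred0 ?ler01 // => A; apply/negP => /andP[AF /and3P[_ PA AC]].
  by move: PF; have -> : P = A by [apply/eqP; rewrite eqEsubset PA eqPC]; rewrite AF.
have card_gt0 : (0 < #|C :\: P|)%N by rewrite card_gt0 setD_eq0; case/andP: ltPC.
rewrite -(ler_pM2r (_ : 0 < #|C :\: P|%:R)) ?ltr0n // mul1r lubell_average //.
rewrite -sumr_const; apply: ler_sum => x /setDP[xC xP].
have xPC : span (x |: P) \subset C by rewrite sub_span_setU1 // xC.
apply: IHm; rewrite ?flat_span //.
rewrite (rank_setU1 geom) //; have := rankS geom q_gt0 xPC.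
by rewrite (rank_setU1 geom) //; lia.
Qed.

(** The averaging argument again, now with equality at the start: P is the only
    flat of rank k in the interval when rank P = k. *)
Lemma lubell_flats_of_rank k P C : flat P -> flat C -> P \subset C ->
  (rank P <= k <= rank C)%N -> lubell (flats_of_rank lines k) P C = 1.
Proof.
move=> flP flC; have [m] := ubnP (rank C - rank P).
elim: m P flP => // m IHm P flP lem PC /andP[lePk lekC].
have [eqPk | nePk] := eqVneq (rank P) k.
  rewrite lubell_id ?inE ?flP ?eqPk ?eqxx // => A.
  rewrite inE => /andP[flA /eqP rkA] PA _.
  by rewrite (flat_rank_eq geom q_gt0 flP flA PA) // rkA eqPk.
have ltPk : (rank P < k)%N by rewrite ltn_neqAle nePk.
have card_gt0 : (0 < #|C :\: P|)%N.
  rewrite card_gt0 setD_eq0; apply: contraL ltPk => CP; rewrite -leqNgt.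
  by rewrite (leq_trans lekC) ?(rankS geom).
apply: (mulIf (_ : #|C :\: P|%:R != 0)); first by rewrite pnatr_eq0 -lt0n.
rewrite mul1r lubell_average //; last by rewrite inE flP.
rewrite -sumr_const; apply: eq_bigr => x /setDP[xC xP].
have xPC : span (x |: P) \subset C by rewrite sub_span_setU1 // xC.
apply: IHm; rewrite ?flat_span // (rank_setU1 geom) //; last by rewrite ltPk.
by lia.
Qed.

(** Complements of A in the interval [P, C], described by the join and the rank;
    that they meet A in P alone then follows from submodularity. *)
Definition complements P A C : {set {set T}} :=
  [set c | [&& flat c, P \subset c, c \subset C,
     rank c + rank A == rank P + rank C & span (A :|: c) == C]]%N.

(** A point x of c outside P cannot lie in A: by submodularity the rank of A v c
    would be too small. Hence P v x lies in c, and the ranks of P v x and A v x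
    exceed those of P and A by one alike, so that c remains a complement; and
    conversely. *)
Lemma complements_setU1 P A C c x : flat P -> flat A -> flat C ->
    P \subset A -> A \subset C ->
  (c \in complements P A C) && (x \in c :\: P) =
  (x \in C :\: A) && (c \in complements (span (x |: P)) (span (x |: A)) C).
Proof.
move=> flP flA flC PA AC; rewrite !inE.
apply/idP/idP.
- case/andP=> /and5P[flc Pc cC /eqP rkc /eqP joinc] /andP[xP xc].
  have xC := subsetP cC x xc.
  have xA : x \notin A.
    apply/negP=> xA; have := rank_setU geom q_gt0 flA flc (flat_span lines (x |: P)).
    rewrite !sub_span_setU1 // xA xc PA Pc -(rank_span geom q_gt0 (A :|: c)) joinc.
    by rewrite (rank_setU1 geom) //; move/(_ isT isT); lia.
  rewrite xA xC flc sub_span_setU1 // xc Pc cC !(rank_setU1 geom) //=.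
  rewrite addnS rkc addSn eqxx /= eqEsubset; apply/andP; split.
    by rewrite span_min // subUset cC andbT sub_span_setU1 // xC.
  rewrite -joinc; apply: spanS; apply: setSU.
  exact: subset_trans (subsetUr _ _) (subset_span _ _).
case/andP=> /andP[xA xC] /and5P[flc]; rewrite sub_span_setU1 // => /andP[xc Pc] cC.
have xP : x \notin P by apply: contraNN xA; apply: subsetP.
rewrite !(rank_setU1 geom) // addnS addSn eqSS => rkc /eqP joinc.
rewrite flc Pc cC rkc xP xc !andbT /= eqEsubset; apply/andP; split.
  by rewrite span_min // subUset AC.
rewrite -joinc; apply: span_min (flat_span _ _) _.
rewrite subUset sub_span_setU1 ?flat_span //.
have Acspan := subset_span lines (A :|: c).
move: (Acspan); rewrite subUset => /andP[-> ->].
by rewrite andbT (subsetP Acspan) // inE xc orbT.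
Qed.

(** Count the pairs of a complement c and a point x of c \ P. With j the rank of
    C over A, each c has q^(rank P) [j]_q such points; on the other hand x is
    any of the q^(rank A) [j]_q points of C \ A, and the complements through x
    are counted by induction on j. *)
Lemma card_complements P A C : flat P -> flat A -> flat C ->
    P \subset A -> A \subset C ->
  #|complements P A C| = (q ^ ((rank A - rank P) * (rank C - rank A)))%N.
Proof.
move=> flP flA flC; move eqj: (rank C - rank A)%N => j.
elim: j P A flP flA eqj => [|j IHj] P A flP flA eqj PA AC.
  rewrite muln0 expn0; apply/eqP/cards1P; exists P.
  have leAC := rankS geom q_gt0 AC.
  have eqAC : A = C by apply: (flat_rank_eq geom q_gt0); lia.
  apply/setP=> c; rewrite !inE; apply/idP/eqP => [/and5P[flc Pc cC rkc _] | ->].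
    by symmetry; apply: (flat_rank_eq geom q_gt0); move: rkc; rewrite eqAC //; lia.
  by rewrite flP subxx -eqAC PA eqxx (setUidPl PA) span_id ?eqxx.
have ltAC : (rank A < rank C)%N by lia.
have lePA := rankS geom q_gt0 PA.
have q0 m : (0 < q ^ m)%N by rewrite expn_gt0 q_gt0.
have qS m : (0 < qnum q m.+1)%N by rewrite qnumS.
apply/eqP; rewrite -(eqn_pmul2r (q0 (rank P))) -(eqn_pmul2r (qS j)); apply/eqP.
transitivity (\sum_(c in complements P A C) \sum_(x in c :\: P) 1)%N.
  rewrite -mulnA -sum_nat_const; apply: eq_bigr => c.
  rewrite inE => /and5P[flc Pc _ /eqP rkc _].
  rewrite sum1_card card_setD_flat //; congr (_ * qnum q _)%N.
  lia.
rewrite (exchange_big_dep [in C :\: A]) /=; last first.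
  by move=> c x cC xc; have := complements_setU1 c x flP flA flC PA AC;
     rewrite cC xc => /esym/andP[].
rewrite (eq_bigr (fun=> q ^ ((rank A - rank P) * j)))%N => [|x /setDP[xC xA]].
  rewrite sum_nat_const card_setD_flat // eqj mulnS expnD.
  have -> : (q ^ rank A = q ^ rank P * q ^ (rank A - rank P))%N.
    by rewrite -expnD subnKC.
  move: (q ^ _)%N (q ^ _)%N (q ^ _)%N (qnum _ _) => a b c d; ring.
have xP : x \notin P by apply: contraNN xA; apply: subsetP.
rewrite (eq_bigl [in complements (span (x |: P)) (span (x |: A)) C]).
  rewrite sum1_card IHj ?flat_span ?(rank_setU1 geom) ?subSS ?spanS ?setUS //.
    by lia.
  by rewrite sub_span_setU1 // xC.
by move=> c; rewrite complements_setU1 // inE xA xC.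
Qed.

End LYM.

(** * Splitting off the first term of a sequence *)

Lemma eq_meshalkin_number q m p (alpha alpha' : 'I_p -> nat) :
  alpha =1 alpha' -> meshalkin_number q m alpha = meshalkin_number q m alpha'.
Proof.
move=> eqa; rewrite /meshalkin_number /gauss_multinomial /s2.
congr (_ / _ * _ ^+ _); first by apply: eq_bigr => k _; rewrite eqa.
by apply: eq_bigr => i _; apply: eq_bigr => j _; rewrite !eqa.
Qed.

Lemma s2_recl p (alpha : 'I_p.+1 -> nat) :
  s2 alpha = (alpha ord0 * (\sum_k alpha (lift ord0 k)) +
              s2 (fun k => alpha (lift ord0 k)))%N.
Proof.
rewrite /s2 big_ord_recl; congr (_ + _)%N.
  by rewrite big_mkcond big_ord_recl /= add0n big_distrr.
apply: eq_bigr => i _; rewrite big_mkcond big_ord_recl /= add0n [RHS]big_mkcond.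
by apply: eq_bigr => j _; rewrite ltnS.
Qed.

Lemma meshalkin_number_recl q m p (alpha : 'I_p.+1 -> nat) : (2 <= q)%N ->
  (\sum_k alpha k)%N = m ->
  meshalkin_number q m alpha =
    qbinom q m (alpha ord0) * q%:R ^+ (alpha ord0 * (m - alpha ord0)) *
    meshalkin_number q (m - alpha ord0) (fun k => alpha (lift ord0 k)).
Proof.
move=> q_ge2; rewrite big_ord_recl => eqm.
rewrite /meshalkin_number /gauss_multinomial /qbinom s2_recl big_ord_recl.
have -> : (\sum_k alpha (lift ord0 k) = m - alpha ord0)%N by rewrite -eqm addKn.
rewrite exprD; set P := \prod_(_ < _) _.
have P0 : P != 0 by apply/prodf_neq0 => k _; rewrite gt_eqF ?qfact_gt0.
have f0 k : qfact q k != 0 by rewrite gt_eqF ?qfact_gt0.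
move: (_ ^+ _) (_ ^+ _) => x y.
by field; rewrite P0 !f0.
Qed.

Lemma meshalkin_number_gt0 q m p (alpha : 'I_p -> nat) : (2 <= q)%N ->
  0 < meshalkin_number q m alpha.
Proof.
move=> q_ge2; rewrite mulr_gt0 ?qexp_gt0 // divr_gt0 ?qfact_gt0 //.
by apply: prodr_gt0 => k _; apply: qfact_gt0.
Qed.

Section Cons.
Variables (T : finType) (p : nat).
Implicit Types (A : {set T}) (b : {ffun 'I_p -> {set T}}).

Definition fcons A b : {ffun 'I_p.+1 -> {set T}} :=
  [ffun k => if unlift ord0 k is Some j then b j else A].

Definition ftail (a : {ffun 'I_p.+1 -> {set T}}) : {ffun 'I_p -> {set T}} :=
  [ffun k => a (lift ord0 k)].

Lemma fcons0 A b : fcons A b ord0 = A.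
Proof. by rewrite ffunE unlift_none. Qed.

Lemma fconsS A b k : fcons A b (lift ord0 k) = b k.
Proof. by rewrite ffunE liftK. Qed.

Lemma fconsK A b : ftail (fcons A b) = b.
Proof. by apply/ffunP=> k; rewrite ffunE fconsS. Qed.

Lemma fcons_tail (a : {ffun 'I_p.+1 -> {set T}}) : fcons (a ord0) (ftail a) = a.
Proof.
by apply/ffunP=> k; rewrite ffunE; case: unliftP => [j ->|->]; rewrite ?ffunE.
Qed.
End Cons.

(** * Meshalkin sequences in a flat *)

Section Meshalkin.
Variables (T : finType) (lines : {set {set T}}) (n q : nat).
Hypothesis (geom : projective_geometry lines n q) (q_ge2 : (2 <= q)%N).
Implicit Types (x y : T) (A C c : {set T}).
Local Notation flat := (Defs.flat lines).
Local Notation span := (Defs.span lines).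
Local Notation rank := (Defs.rank lines).
Local Notation ranks := (Defs.ranks lines).

Let q_gt0 : (0 < q)%N := ltnW q_ge2.

Definition hull p (b : {ffun 'I_p -> {set T}}) : {set T} := span (\bigcup_k b k).

(** Meshalkin sequences relative to a flat C, so that the induction on the length
    can pass from C to a complement of the first term. *)
Definition meshalkin_in p C (a : {ffun 'I_p -> {set T}}) : bool :=
  [&& [forall k, flat (a k)], hull a == C & (\sum_k rank (a k))%N == rank C].

Lemma rank_join A c : (rank (A :|: c) <= rank A + rank c)%N.
Proof.
have := rank_setU geom q_gt0 (flat_span lines A) (flat_span lines c) (flat0 lines).
rewrite !(rank_span geom) // (rank0 geom) // addn0 => /(_ (sub0set _) (sub0set _)).
by apply: leq_trans; rewrite (rankS geom) // setUSS // subset_span.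
Qed.

Lemma rank_hull p (b : {ffun 'I_p -> {set T}}) :
  (rank (hull b) <= \sum_k rank (b k))%N.
Proof.
rewrite (rank_span geom) //; elim/big_rec2: _ => [|k r A _ leAr].
  by rewrite (rank0 geom).
by apply: leq_trans (rank_join _ _) _; rewrite leq_add2l.
Qed.

Lemma hull_fcons p A (b : {ffun 'I_p -> {set T}}) :
  hull (fcons A b) = span (A :|: hull b).
Proof.
rewrite span_spanU /hull big_ord_recl fcons0; congr (span (_ :|: _)).
by apply: eq_bigr => k _; rewrite fconsS.
Qed.

(** The rank of the hull of the tail is at most the sum of the ranks of the tail,
    and at least rank C - rank A; both are equal here, which makes the hull a
    complement of A and the tail a Meshalkin sequence in the hull. *)
Lemma meshalkin_in_fcons p A C (b : {ffun 'I_p -> {set T}}) : flat C ->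
  meshalkin_in C (fcons A b) =
  [&& flat A && (A \subset C), hull b \in complements lines set0 A C
    & meshalkin_in (hull b) b].
Proof.
move=> flC; rewrite /meshalkin_in hull_fcons big_ord_recl fcons0 inE /=.
have -> : (\sum_(i < p) rank (fcons A b (lift ord0 i)) = \sum_(i < p) rank (b i))%N.
  by apply: eq_bigr => k _; rewrite fconsS.
have -> : [forall k, flat (fcons A b k)] = flat A && [forall k, flat (b k)].
  apply/forallP/andP=> [flAb | [flA /forallP flb] k].
    split; first by rewrite -(fcons0 A b).
    by apply/forallP=> k; rewrite -(fconsS A b).
  by rewrite ffunE; case: unlift.
rewrite eqxx flat_span sub0set (rank0 geom) // add0n /=.
have leA := rank_join A (hull b).
move: (rank_hull b); move: (\sum_(i < p) rank (b i))%N => s leb.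
apply/idP/idP.
- case/and3P=> /andP[-> ->] /eqP joinC /eqP rkC.
  have := leA; rewrite -(rank_span geom q_gt0) joinC => leC.
  have AhC := subset_span lines (A :|: hull b).
  rewrite joinC subUset in AhC; case/andP: AhC => -> ->.
  rewrite eqxx /= andbT; apply/andP; split; apply/eqP; lia.
case/and3P=> /andP[-> AC] /and3P[_ /eqP rkC joinC] /andP[-> /eqP rkb].
by rewrite joinC rkb -rkC addnC /=.
Qed.

Definition tail_fiber p (M : {set {ffun 'I_p.+1 -> {set T}}}) A c :
    {set {ffun 'I_p -> {set T}}} :=
  [set b | (fcons A b \in M) && (hull b == c)].

Definition weight p C (a : {ffun 'I_p -> {set T}}) : rat :=
  (meshalkin_number q (rank C) (ranks a))^-1.

Lemma weight_fcons p A C (b : {ffun 'I_p -> {set T}}) : flat C ->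
  meshalkin_in C (fcons A b) ->
  weight C (fcons A b) =
    (qbinom q (rank C) (rank A) * q%:R ^+ (rank A * (rank C - rank A)))^-1 *
    weight (hull b) b.
Proof.
move=> flC meshC; have /and3P[_ _ /eqP rkC] := meshC.
move: meshC; rewrite meshalkin_in_fcons // inE (rank0 geom) // add0n.
case/and3P=> _ /and5P[_ _ _ /eqP rkh _] _.
rewrite /weight (meshalkin_number_recl q_ge2 rkC) invfM /Defs.ranks fcons0.
congr (_ * (_)^-1); rewrite -rkh addnK; apply: eq_meshalkin_number => k.
by rewrite fconsS.
Qed.

Lemma sum_weight_recl p C (M : {set {ffun 'I_p.+1 -> {set T}}}) : flat C ->
  {in M, forall a, meshalkin_in C a} ->
  \sum_(a in M) weight C a =
  \sum_(A | flat A && (A \subset C)) \sum_(c in complements lines set0 A C)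
    (qbinom q (rank C) (rank A) * q%:R ^+ (rank A * (rank C - rank A)))^-1 *
    \sum_(b in tail_fiber M A c) weight c b.
Proof.
move=> flC meshM.
have meshM' a : a \in M -> meshalkin_in C (fcons (a ord0) (ftail a)).
  by move/meshM; rewrite fcons_tail.
rewrite (partition_big (fun a : {ffun 'I_p.+1 -> {set T}} => a ord0)
   (fun A => flat A && (A \subset C))) => [|a aM]; last first.
  by have := meshM' a aM; rewrite meshalkin_in_fcons // => /and3P[].
apply: eq_bigr => A _.
rewrite (partition_big (fun a => hull (ftail a)) [in complements lines set0 A C])
   => [|a /andP[aM /eqP<-]]; last first.
  by have := meshM' a aM; rewrite meshalkin_in_fcons // => /and3P[].
apply: eq_bigr => c _; rewrite mulr_sumr.
rewrite (reindex_onto (fcons A) (@ftail _ _))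
   => [|a /andP[/andP[_ /eqP<-] _]]; last first.
  exact: fcons_tail.
rewrite (eq_bigl [in tail_fiber M A c]) => [|b]; last first.
  by rewrite fcons0 fconsK !eqxx !andbT inE.
apply: eq_bigr => b; rewrite inE => /andP[bM /eqP<-].
by rewrite weight_fcons //; apply: meshM.
Qed.

(** The number of complements of A in C is the power of q in the summand. *)
Lemma sum_complements A C : flat A -> flat C -> A \subset C ->
  \sum_(c in complements lines set0 A C)
    (qbinom q (rank C) (rank A) * q%:R ^+ (rank A * (rank C - rank A)))^-1 =
  (qbinom q (rank C) (rank A))^-1.
Proof.
move=> flA flC AC; rewrite sumr_const.
rewrite (card_complements geom) ?flat0 ?sub0set // (rank0 geom) // subn0.
rewrite -[LHS]mulr_natr natrX invfM -mulrA mulVf ?mulr1 //.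
by rewrite gt_eqF ?qexp_gt0.
Qed.

Lemma sum_weight0 C (M : {set {ffun 'I_0 -> {set T}}}) :
  {in M, forall a, meshalkin_in C a} -> \sum_(a in M) weight C a = #|M|%:R.
Proof.
move=> meshM; rewrite -sumr_const; apply: eq_bigr => a /meshM/and3P[_ _].
rewrite big_ord0 => /eqP eq0.
rewrite /weight /meshalkin_number /gauss_multinomial /s2 -eq0 !big_ord0.
by rewrite qfact0 !(mulr1, invr1).
Qed.

Lemma component_tail_fiber p (M : {set {ffun 'I_p.+1 -> {set T}}}) A c (k : 'I_p) :
  component (tail_fiber M A c) k \subset component M (lift ord0 k).
Proof.
apply/subsetP=> D /imsetP[b]; rewrite inE => /andP[bM _] ->.
by apply/imsetP; exists (fcons A b); rewrite ?fconsS.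
Qed.

Lemma sub_antichain (F G : {set {set T}}) :
  F \subset G -> antichain G -> antichain F.
Proof. by move=> /subsetP FG antiG A B /FG AG /FG; apply: antiG. Qed.

(** By induction each tail family contributes at most 1, and nothing if A is not a
    first term; summing over complements and then over first terms leaves the LYM
    sum of the first component. For sequences of length 1 this component is an
    antichain because C is its only possible member. *)
Lemma sum_weight_le1 p C (M : {set {ffun 'I_p -> {set T}}}) : flat C ->
  {in M, forall a, meshalkin_in C a} ->
  (forall k : 'I_p, (k.+1 < p)%N -> antichain (component M k)) ->
  \sum_(a in M) weight C a <= 1.
Proof.
elim: p C M => [|p IHp] C M flC meshM antiM.
  rewrite sum_weight0 // (_ : 1 = 1%:R) // ler_nat.
  by rewrite (leq_trans (max_card _)) // card_ffun card_ord expn0.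
have anti0 : antichain (component M ord0).
  case: p {IHp} M meshM antiM => [|p] M meshM antiM; last exact: antiM.
  have comp0 A : A \in component M ord0 -> A = C.
    case/imsetP=> a /meshM/and3P[/forallP/(_ ord0) fla /eqP <- _] ->.
    by rewrite /hull big_ord1 span_id.
  by move=> A B /comp0-> /comp0->; rewrite properxx.
rewrite sum_weight_recl //.
apply: le_trans (lubell_le1 geom q_ge2 anti0 (flat0 lines) flC (sub0set _)).
rewrite /lubell (rank0 geom) // subn0 [leRHS](eq_bigl (fun A =>
   (flat A && (A \subset C)) && (A \in component M ord0))) => [|A]; last first.
  by rewrite sub0set /= andbC.
rewrite [leRHS]big_mkcondr; apply: ler_sum => A /andP[flA AC]; rewrite subn0.
case: ifP => [_ | noA]; last first.
  rewrite big1 // => c _; rewrite [X in _ * X]big1 ?mulr0 // => b.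
  rewrite inE => /andP[bM _].
  by case/imsetP: noA; exists (fcons A b); rewrite ?fcons0.
rewrite -(sum_complements flA) //; apply: ler_sum => c.
rewrite inE => /and5P[flc _ _ _ _].
rewrite -[leRHS]mulr1; apply: ler_wpM2l.
  by rewrite invr_ge0 mulr_ge0 // ltW ?qbinom_gt0 ?qexp_gt0.
apply: IHp => // [b|k ltk].
  rewrite inE => /andP[/meshM]; rewrite meshalkin_in_fcons // => /and3P[_ _ meshb].
  by move/eqP<-.
by apply: sub_antichain (component_tail_fiber _ _ _ _) _; apply: antiM.
Qed.

Definition meshalkin_of_ranks p C (alpha : 'I_p -> nat) :
    {set {ffun 'I_p -> {set T}}} :=
  [set a | meshalkin_in C a && [forall k, rank (a k) == alpha k]].

(** The recursion of [sum_weight_le1], in which the tail families are complete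
    again and the first terms are all the flats of one rank in C. *)
Lemma sum_weight_of_ranks p C (alpha : 'I_p -> nat) : flat C ->
  (\sum_k alpha k)%N = rank C ->
  \sum_(a in meshalkin_of_ranks C alpha) weight C a = 1.
Proof.
elim: p C alpha => [|p IHp] C alpha flC sumC.
  rewrite sum_weight0 => [|a]; last by rewrite inE => /andP[].
  have C0 : C = set0.
    apply/esym/(flat_rank_eq geom q_gt0 (flat0 lines) flC (sub0set _)).
    by rewrite -sumC big_ord0.
  apply/eqP; rewrite pnatr_eq1; apply/cards1P; exists [ffun k => set0].
  apply/setP=> a; rewrite !inE.
  have -> : a = [ffun k => set0] by apply/ffunP=> -[].
  rewrite eqxx /meshalkin_in /hull C0 !big_ord0 span_id ?flat0 //.
  rewrite eqxx (rank0 geom) //.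
  have all0 (Q : pred 'I_0) : [forall k, Q k] by apply/forallP=> -[].
  by rewrite !all0.
rewrite sum_weight_recl //; last by move=> a; rewrite inE => /andP[].
have le0 : (alpha ord0 <= rank C)%N by rewrite -sumC big_ord_recl leq_addr.
rewrite -[RHS](lubell_flats_of_rank geom q_ge2 (flat0 lines) flC (sub0set _)
  (k := alpha ord0));
  last by rewrite (rank0 geom).
rewrite /lubell (rank0 geom) // subn0 [RHS](eq_bigl (fun A =>
   (flat A && (A \subset C)) && (rank A == alpha ord0))) => [|A]; last first.
  by rewrite inE sub0set /=; case: (flat A) => //=; rewrite andbC.
rewrite [RHS]big_mkcondr; apply: eq_bigr => A /andP[flA AC]; rewrite subn0.
case: ifP => [/eqP rkA | noA]; last first.
  rewrite big1 // => c _; rewrite [X in _ * X]big1 ?mulr0 // => b.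
  by rewrite !inE => /andP[/andP[_ /forallP/(_ ord0)]]; rewrite fcons0 noA.
rewrite -(sum_complements flA) //; apply: eq_bigr => c compc.
have := compc; rewrite inE (rank0 geom) // add0n.
case/and5P=> flc _ _ /eqP rkc joinc.
rewrite -[RHS]mulr1; congr (_ * _).
rewrite -[RHS](IHp c (fun k => alpha (lift ord0 k)) flc); last first.
  by move: sumC; rewrite big_ord_recl -rkc -rkA addnC => /addIn.
apply: eq_bigl => b; rewrite inE [fcons A b \in _]inE [in RHS]inE.
rewrite meshalkin_in_fcons // flA AC /=.
have -> : [forall k, rank (fcons A b k) == alpha k] =
          [forall k, rank (b k) == alpha (lift ord0 k)].
  apply/forallP/forallP=> rkb k; first by rewrite -(fconsS A b).
  by rewrite ffunE; case: unliftP => [j ->|->] //; rewrite rkA.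
have [eqbc|nebc] := eqVneq (hull b) c; first by rewrite eqbc compc !andbT.
rewrite andbF; apply/esym/negP=> /andP[/and3P[_ /eqP hc _] _].
by rewrite hc eqxx in nebc.
Qed.

End Meshalkin.

(** * The largest Meshalkin number *)

Lemma bin2D m k : 'C(m + k, 2) = ('C(m, 2) + 'C(k, 2) + m * k)%N.
Proof.
elim: m => [|m IHm]; first by rewrite bin0n mul0n addn0.
by rewrite addSn !binS !bin1 IHm mulSn; lia.
Qed.

Lemma s2_bin2 p (alpha : 'I_p -> nat) :
  (s2 alpha + \sum_k 'C(alpha k, 2) = 'C(\sum_k alpha k, 2))%N.
Proof.
elim: p alpha => [|p IHp] alpha; first by rewrite /s2 !big_ord0.
rewrite s2_recl !big_ord_recl bin2D -IHp /=.
move: (s2 _) (\sum_(_ < _) 'C(_, _))%N (alpha _ * _)%N => x y z; lia.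
Qed.

Section Optimum.
Variable q : nat.
Hypothesis q_ge2 : (2 <= q)%N.

(** The factor that a part of size m contributes to the denominator of a Meshalkin
    number, once q^(s2 alpha) is rewritten with [s2_bin2]. *)
Definition part_cost (m : nat) : rat := qfact q m * q%:R ^+ 'C(m, 2).

(** The quotient of the costs of m + 1 and m. *)
Definition cost_ratio (m : nat) : rat := q%:R ^+ m * (q%:R ^+ m.+1 - 1).

Lemma part_cost_gt0 m : 0 < part_cost m.
Proof. by rewrite mulr_gt0 ?qfact_gt0 ?qexp_gt0. Qed.

Lemma part_costS m : part_cost m.+1 = part_cost m * cost_ratio m.
Proof.
by rewrite /part_cost qfactS binS bin1 exprD /cost_ratio; ring.
Qed.

Lemma cost_ratio_gt0 m : 0 < cost_ratio m.
Proof. by rewrite mulr_gt0 ?qexp_gt0 // subr_gt0 qexp_gt1. Qed.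

Lemma cost_ratio_le m k : (m <= k)%N -> cost_ratio m <= cost_ratio k.
Proof.
move=> lemk; have q1 : 1 <= q%:R :> rat by rewrite ler1n ltnW.
apply: ler_pM; first exact/ltW/qexp_gt0.
- by rewrite subr_ge0 exprn_ege1.
- by rewrite ler_weXn2l.
by rewrite lerB // ler_weXn2l.
Qed.

(** Log-convexity: f(m) >= f(t) r^(m - t), where r = f(t+1) / f(t). The powers of r
    are spread over both sides to keep the exponents nonnegative when m < t. *)
Lemma part_cost_tangent t m :
  part_cost t * cost_ratio t ^+ m <= part_cost m * cost_ratio t ^+ t.
Proof.
have r_ge0 k : 0 <= cost_ratio k by apply/ltW/cost_ratio_gt0.
have c_ge0 k : 0 <= part_cost k by apply/ltW/part_cost_gt0.
have rX_ge0 k d : 0 <= cost_ratio k ^+ d by rewrite exprn_ge0.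
have [letm | /ltnW lemt] := leqP t m.
  rewrite -(subnKC letm) exprD mulrCA mulrC; apply: ler_wpM2r => //.
  elim: (m - t)%N => [|d IHd]; first by rewrite mulr1 addn0.
  rewrite addnS part_costS exprSr mulrA.
  by apply: ler_pM => //; [apply: mulr_ge0 | rewrite cost_ratio_le ?leq_addr].
have growth d : (m + d <= t)%N ->
    part_cost (m + d) <= part_cost m * cost_ratio t ^+ d.
  elim: d => [|d IHd] led; first by rewrite mulr1 addn0.
  rewrite addnS part_costS exprSr mulrA.
  by apply: ler_pM => //; [apply: IHd | apply: cost_ratio_le]; lia.
have := growth (t - m)%N; rewrite subnKC // => /(_ (leqnn t)) le_t.
rewrite -[X in _ <= _ * _ ^+ X](subnKC lemt) exprD mulrCA mulrC.
exact: ler_wpM2l.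
Qed.

Lemma part_cost_balanced t m : m = t \/ m = t.+1 ->
  part_cost m * cost_ratio t ^+ t = part_cost t * cost_ratio t ^+ m.
Proof. by case=> ->; rewrite // part_costS exprS mulrA. Qed.

Lemma meshalkin_number_cost m p (alpha : 'I_p -> nat) : (\sum_k alpha k)%N = m ->
  meshalkin_number q m alpha * \prod_k part_cost (alpha k) = part_cost m.
Proof.
move=> sum_alpha; rewrite big_split /= prodrXr /meshalkin_number /gauss_multinomial.
rewrite /part_cost -sum_alpha -s2_bin2 exprD.
have P0 : \prod_k qfact q (alpha k) != 0.
  by apply/prodf_neq0 => k _; rewrite gt_eqF ?qfact_gt0.
by move: (_ ^+ _) (_ ^+ _) => x y; field.
Qed.

(** Multiplying the tangent inequalities over all parts gives a bound that depends
    only on the sum of the parts, and parts t and t + 1 attain it. *)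
Lemma meshalkin_number_le_balanced m p t (alpha gamma : 'I_p -> nat) :
    (\sum_k alpha k)%N = m -> (\sum_k gamma k)%N = m ->
    (forall k, gamma k = t \/ gamma k = t.+1) ->
  meshalkin_number q m alpha <= meshalkin_number q m gamma.
Proof.
move=> sum_alpha sum_gamma bal_gamma.
have cost_gt0 (d : 'I_p -> nat) : 0 < \prod_k part_cost (d k).
  by apply: prodr_gt0 => k _; apply: part_cost_gt0.
rewrite -(ler_pM2r (cost_gt0 alpha)) (meshalkin_number_cost sum_alpha).
rewrite -(meshalkin_number_cost sum_gamma) ler_pM2l ?meshalkin_number_gt0 //.
have rX_gt0 : 0 < \prod_(k < p) cost_ratio t ^+ t.
  by apply: prodr_gt0 => k _; rewrite exprn_gt0 ?cost_ratio_gt0.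
rewrite -(ler_pM2r rX_gt0) -!big_split /=.
rewrite (eq_bigr _ (fun k _ => part_cost_balanced (bal_gamma k))).
rewrite big_split /= prodrXr sum_gamma -sum_alpha -prodrXr -big_split /=.
apply: ler_prod => k _; rewrite part_cost_tangent andbT.
by rewrite ltW // mulr_gt0 ?part_cost_gt0 ?exprn_gt0 ?cost_ratio_gt0.
Qed.

Lemma ceil_divE m p : (0 < p)%N -> ceil_div m p = (floor_div m p + (0 < m %% p))%N.
Proof.
move=> p_gt0; rewrite /ceil_div /floor_div {1}(divn_eq m p) -addnA divnMDl //.
congr (_ + _)%N; have := ltn_pmod m p_gt0; case: (m %% p)%N => [|r] ltrp /=.
  by rewrite add0n divn_small // ltn_predL.
rewrite addSnnS prednK // -{1}[p]mul1n addnC divnMDl // divn_small ?addn0 //.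
exact: ltnW.
Qed.

Lemma floor_or_ceil m p k : (0 < p)%N -> k = ceil_div m p \/ k = floor_div m p ->
  k = floor_div m p \/ k = (floor_div m p).+1.
Proof.
move=> p_gt0; rewrite ceil_divE //.
by case: (0 < _)%N => -[] ->; rewrite ?addn0 ?addn1; [right | left | left | left].
Qed.

Lemma beta_balanced m p (k : 'I_p) :
  beta m k = floor_div m p \/ beta m k = (floor_div m p).+1.
Proof.
apply: floor_or_ceil; first exact: leq_ltn_trans (ltn_ord k).
by rewrite /beta; case: ifP => _; [left | right].
Qed.

Lemma sum_beta m p : (0 < p)%N -> (\sum_k @beta m p k)%N = m.
Proof.
move=> p_gt0; have lemod := ltnW (ltn_pmod m p_gt0).
rewrite (eq_bigr (fun k : 'I_p => floor_div m p + (k < m %% p)))%N => [|k _].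
  rewrite big_split /= sum_nat_const card_ord mulnC.
  rewrite (_ : \sum_(k < p) _ = m %% p)%N -?divn_eq //.
  rewrite (eq_bigr (fun k : 'I_p => if k < m %% p then 1 else 0))%N.
    by rewrite -big_mkcond -(big_ord_widen p (fun=> 1%N)) //
      sum_nat_const card_ord muln1.
  by move=> k _; case: ifP.
rewrite /beta ceil_divE //; case: ifP => [ltk|_]; last by rewrite addn0.
by rewrite (leq_ltn_trans _ ltk).
Qed.

Lemma meshalkin_number_le_max m p (alpha : 'I_p -> nat) : (\sum_k alpha k)%N = m ->
  meshalkin_number q m alpha <= max_meshalkin_number q m p.
Proof.
move=> sum_alpha.
have alpha_lt k : (alpha k < m.+1)%N.
  by rewrite ltnS -sum_alpha (bigD1 k) // leq_addr.
pose a := [ffun k => Ordinal (alpha_lt k)].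
have aE k : nat_of_ord (a k) = alpha k by rewrite ffunE.
rewrite -(eq_meshalkin_number q m aE); apply: le_bigmax_cond.
by rewrite (eq_bigr alpha) ?sum_alpha.
Qed.

Lemma max_meshalkin_number_beta m p : (0 < p)%N ->
  max_meshalkin_number q m p = meshalkin_number q m (@beta m p).
Proof.
move=> p_gt0; have sum_b := sum_beta m p_gt0.
apply/le_anti; rewrite meshalkin_number_le_max // andbT.
apply: bigmax_le => [|a /eqP sum_a]; first exact/ltW/meshalkin_number_gt0.
exact: meshalkin_number_le_balanced sum_a sum_b (@beta_balanced m p).
Qed.

End Optimum.

(** * The Meshalkin theorem for projective geometries *)

Theorem corollary6 (n p q : nat) (T : finType) (lines : {set {set T}})
    (M : {set {ffun 'I_p -> {set T}}})
    (p_ge2 : (2 <= p)%N) (q_ge2 : (2 <= q)%N)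
    (geom : projective_geometry lines n q)
    (meshM : forall a, a \in M -> meshalkin lines n a)
    (antiM : forall k : 'I_p, (k.+1 < p)%N -> antichain (component M k)) :
  [/\ \sum_(a in M) (meshalkin_number q n (ranks lines a))^-1 <= 1,
      (#|M|%:R <= max_meshalkin_number q n p) /\
      (max_meshalkin_number q n p = meshalkin_number q n (@beta n p))
    & (forall a, meshalkin lines n a ->
         (forall k, a k \in component M k) -> a \in M) ->
      (forall k, component M k = flats_of_rank lines (ceil_div n p) \/
                 component M k = flats_of_rank lines (floor_div n p)) ->
      (\sum_(a in M) (meshalkin_number q n (ranks lines a))^-1 = 1) /\
      (#|M|%:R = max_meshalkin_number q n p)].
Proof.
have p_gt0 : (0 < p)%N by apply: ltnW.
have flT : flat lines setT by apply/flatP=> *; apply: subsetT.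
have rkT : Defs.rank lines setT = n := pg_rank geom.
have meshP a : reflect (meshalkin lines n a) (meshalkin_in lines setT a).
  apply: (iffP and3P) => [[/forallP fla /eqP joina /eqP rka] | [fla joina rka]].
    by split=> //; rewrite -rkT.
  by split; [apply/forallP | apply/eqP | rewrite rkT; apply/eqP].
have sum_le1 : \sum_(a in M) (meshalkin_number q n (ranks lines a))^-1 <= 1.
  rewrite -rkT; apply: (sum_weight_le1 geom q_ge2 flT) antiM => a aM.
  exact/meshP/meshM.
have max_gt0 : 0 < max_meshalkin_number q n p.
  by rewrite max_meshalkin_number_beta // meshalkin_number_gt0.
split=> // [|full compM].
  split; last exact: max_meshalkin_number_beta.
  rewrite -[leRHS]mulr1 -ler_pdivrMl // mulrC mulr_natl.
  apply: le_trans sum_le1; rewrite -sumr_const; apply: ler_sum => a /meshM[_ _ rka].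
  by rewrite lef_pV2 ?posrE ?meshalkin_number_gt0 // meshalkin_number_le_max.
pose alpha (k : 'I_p) :=
  if component M k == flats_of_rank lines (ceil_div n p) then ceil_div n p
  else floor_div n p.
have compE k : component M k = flats_of_rank lines (alpha k).
  by rewrite /alpha; case: eqP => // ne; case: (compM k).
have alpha_bal k : alpha k = floor_div n p \/ alpha k = (floor_div n p).+1.
  by apply: floor_or_ceil => //; rewrite /alpha; case: ifP => _; [left | right].
have rkM a k : a \in M -> ranks lines a k = alpha k.
  move=> aM; have : a k \in component M k by apply/imsetP; exists a.
  by rewrite compE inE => /andP[_ /eqP].
(* By equality in LYM there is a flat of each rank up to n, so the first component
   is not empty. *)
have [a0 a0M] : exists a, a \in M.
  pose k0 := Ordinal p_gt0.
  have le_n : (alpha k0 <= n)%N.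
    have ceil_le : (ceil_div n p <= n)%N.
      rewrite ceil_divE // /floor_div {3}(divn_eq n p) leq_add ?leq_pmulr //.
      by case: (n %% p)%N.
    by rewrite /alpha; case: ifP; rewrite // leq_div.
  have /set0Pn[A /imsetP[a aM _]] : component M k0 != set0.
    apply/eqP=> comp0.
    have := lubell_flats_of_rank geom q_ge2 (flat0 lines) flT (sub0set _)
      (k := alpha k0).
    rewrite (rank0 geom (ltnW q_ge2)) rkT le_n -compE comp0 => /(_ isT)/esym/eqP.
    by rewrite /lubell big_pred0 ?oner_eq0 // => A; rewrite inE.
  by exists a.
have sum_alpha : (\sum_k alpha k)%N = n.
  have [_ _ <-] := meshM a0 a0M.
  by apply: eq_bigr => k _; rewrite rkM.
have ME : M = meshalkin_of_ranks lines setT alpha.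
  apply/setP=> a; rewrite inE; apply/idP/andP => [aM | [/meshP mesha /forallP rka]].
    by split; [apply/meshP/meshM | apply/forallP=> k; rewrite -(rkM a k aM)].
  apply: full => // k; rewrite compE inE rka andbT.
  by have [fla _ _] := mesha.
have sum1 : \sum_(a in M) (meshalkin_number q n (ranks lines a))^-1 = 1.
  by rewrite ME -rkT; apply: (sum_weight_of_ranks geom q_ge2 flT); rewrite rkT.
split=> //; move: sum1; rewrite (eq_bigr (fun=> (max_meshalkin_number q n p)^-1)).
  have max_neq0 : max_meshalkin_number q n p != 0 by rewrite gt_eqF.
  rewrite sumr_const -[X in X = _]mulr_natl => /(canRL (divfK max_neq0)).
  by rewrite mul1r.
move=> a aM; congr _^-1; rewrite (eq_meshalkin_number _ _ (rkM a ^~ aM)).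
apply/le_anti; rewrite meshalkin_number_le_max // max_meshalkin_number_beta //.
exact: meshalkin_number_le_balanced (sum_beta n p_gt0) sum_alpha alpha_bal.
Qed.
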